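(* Consider the delayed constrained online convex optimization problem and the DTC-OCO algorithm with feedback delay $\tau\ge 1$ described in the context, and suppose Assumptions 1, 2 and 3 of the context hold. Then for any $\alpha,\eta,\gamma>0$ and any $c\in\mathcal{C}$, the constraint violation $\mathrm{VO}^c(T)=\sum_{t=1}^{T}g_t^c(\mathbf{x}_t)$ of DTC-OCO is upper bounded by $$\mathrm{VO}^c(T)\le 2G+\frac{2\gamma^2G^2+DR+(\alpha+\eta)R^2}{\epsilon\gamma^2}+\tau\tilde{\Delta}_{\mathbf g}+G\tau .$$
   Context: Problem data. $T\ge1$ is the time horizon and $\tau\ge1$ an integer (feedback delay). $\mathcal{X}_0\subseteq\mathbb{R}^n$ is a compact convex set. For $t=1,2,\dots$, $f_t:\mathbb{R}^n\to\mathbb{R}$ is a convex differentiable loss function and $\mathbf{g}_t=[g_t^1,\dots,g_t^C]^T:\mathbb{R}^n\to\mathbb{R}^C$ is a constraint function with each component $g_t^c$ convex, $c\in\mathcal{C}=\{1,\dots,C\}$. $\preceq,\succeq$ are entrywise inequalities. Assumptions. (1) There is $D>0$ with $\|\nabla f_t(\mathbf{x})\|_2\le D$ for all $\mathbf{x}\in\mathcal{X}_0$ and all $t$. (2.1) There is $\beta>0$ with $\|\mathbf{g}_t(\mathbf{x})-\mathbf{g}_t(\mathbf{y})\|_2\le\beta\|\mathbf{x}-\mathbf{y}\|_2$ for all $\mathbf{x},\mathbf{y}\in\mathcal{X}_0$ and all $t$. (2.2) There is $G>0$ with $\|\mathbf{g}_t(\mathbf{x})\|_2\le G$ for all $\mathbf{x}\in\mathcal{X}_0$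 and all $t$. (2.3) There is $\epsilon>0$ such that for every $t$ there is $\tilde{\mathbf{x}}_t\in\mathcal{X}_0$ with $\mathbf{g}_t(\tilde{\mathbf{x}}_t)\preceq-\epsilon\mathbf{1}$. (3) There is $R>0$ with $\|\mathbf{x}-\mathbf{y}\|_2\le R$ for all $\mathbf{x},\mathbf{y}\in\mathcal{X}_0$. DTC-OCO algorithm with parameters $\alpha,\eta,\gamma>0$. Initialization: $\mathbf{x}_t\in\mathcal{X}_0$ arbitrary and $\mathbf{Q}_t=\mathbf{0}\in\mathbb{R}^C$ for $1\le t\le\tau$, and $\mathbf{g}_0(\mathbf{x})\equiv\mathbf{0}$. For each $t>\tau$: first, $\mathbf{x}_t$ is the minimizer over $\mathbf{x}\in\mathcal{X}_0$ of $$[\nabla f_{t-\tau}(\mathbf{x}_{t-\tau})]^T(\mathbf{x}-\mathbf{x}_{t-\tau})+[\mathbf{Q}_{t-1}+\gamma\mathbf{g}_{t-\tau-1}(\mathbf{x}_{t-1})]^T[\gamma\mathbf{g}_{t-\tau}(\mathbf{x})]+\alpha\|\mathbf{x}-\mathbf{x}_{t-\tau}\|_2^2+\eta\|\mathbf{x}-\mathbf{x}_{t-1}\|_2^2;$$ then the virtual queue $\mathbf{Q}_t=[Q_t^1,\dots,Q_t^C]^T$ is updated for each $c\in\mathcal{C}$ by $Q_t^c=\max\{-\gamma g_{t-\tau}^c(\mathbf{x}_t),\,Q_{t-1}^c+\gamma g_{t-\tau}^c(\mathbf{x}_t)\}$. Variation measure. $\tilde{\Delta}_{\mathbf g}=\sum_{t=1}^T\max_{\mathbf{x}\in\mathcal{X}_0}\|\mathbf{g}_t(\mathbf{x})-\mathbf{g}_{t-1}(\mathbf{x})\|_2$.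 *)

(* Defs.v *)
From mathcomp Require Import all_boot all_order all_algebra.
From mathcomp Require Import all_classical all_reals all_analysis.
Set Implicit Arguments.
Unset Strict Implicit.
Unset Printing Implicit Defensive.
Import Order.TTheory GRing.Theory Num.Theory numFieldNormedType.Exports.
Local Open Scope classical_set_scope.
Local Open Scope ring_scope.

Definition dotv {R : realType} {n : nat} (u v : 'rV[R]_n) : R :=
  \sum_(i < n) u 0 i * v 0 i.

(* The library norm `|u| on 'rV[R]_n is the sup norm, hence this one. Both
   induce the same topology, so [compact] and [differentiable] are unaffected. *)
Definition l2norm {R : realType} {n : nat} (u : 'rV[R]_n) : R :=
  Num.sqrt (\sum_(i < n) u 0 i ^+ 2).

Definition grad {R : realType} {n : nat} (f : 'rV[R]_n -> R) (x : 'rV[R]_n) :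
    'rV[R]_n :=
  \row_(i < n) 'D_(delta_mx 0 i) f x.

Definition is_minimizer {R : realType} {n : nat} (A : set 'rV[R]_n)
    (F : 'rV[R]_n -> R) (x : 'rV[R]_n) : Prop :=
  A x /\ forall y, A y -> F x <= F y.

Section DTC_OCO.
Context {R : realType} {n C : nat}.
Variables (X0 : set 'rV[R]_n) (f : nat -> 'rV[R]_n -> R)
  (g : nat -> 'rV[R]_n -> 'rV[R]_C) (tau : nat) (alpha eta gamma : R).

(* For t > tau >= 1 the natural-number subtractions t - tau, t - tau - 1 and
   t - 1 are exact. *)
Definition dtc_objective (x : nat -> 'rV[R]_n) (Q : nat -> 'rV[R]_C) (t : nat)
    (y : 'rV[R]_n) : R :=
  dotv (grad (f (t - tau)%N) (x (t - tau)%N)) (y - x (t - tau)%N)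
  + dotv (Q (t - 1)%N + gamma *: g (t - tau - 1)%N (x (t - 1)%N))
         (gamma *: g (t - tau)%N y)
  + alpha * l2norm (y - x (t - tau)%N) ^+ 2
  + eta * l2norm (y - x (t - 1)%N) ^+ 2.

(* The values x 0 and Q 0 are unconstrained and unused: time starts at 1. *)
Record dtc_oco (x : nat -> 'rV[R]_n) (Q : nat -> 'rV[R]_C) : Prop := {
  dtc_init_x : forall t, (1 <= t <= tau)%N -> X0 (x t);
  dtc_init_Q : forall t, (1 <= t <= tau)%N -> Q t = 0;
  dtc_x : forall t, (tau < t)%N -> is_minimizer X0 (dtc_objective x Q t) (x t);
  dtc_Q : forall t, (tau < t)%N -> forall c : 'I_C,
    Q t 0 c = Num.max (- (gamma * g (t - tau)%N (x t) 0 c))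
                      (Q (t - 1)%N 0 c + gamma * g (t - tau)%N (x t) 0 c) }.

Definition violation (x : nat -> 'rV[R]_n) (c : 'I_C) (T : nat) : R :=
  \sum_(1 <= t < T.+1) g t (x t) 0 c.

(* The supremum is a maximum whenever X0 is nonempty and compact and all the
   g t are continuous on X0. *)
Definition g_variation (T : nat) : R :=
  \sum_(1 <= t < T.+1) sup [set l2norm (g t y - g (t - 1)%N y) | y in X0].

End DTC_OCO.

(* Main.v *)
(* Comparing the value of the objective at x_t with its value at a Slater point
   shows that the virtual queue has nonpositive drift as soon as it is large,
   so it stays bounded. Since gamma g_{t-tau}(x_t) <= Q_t - Q_{t-1}
   coordinatewise, the delayed violation, the sum of the g_{t-tau}(x_t), is at
   most Q_T / gamma. Replacing g_{t-tau} by g_t costs at most tau times the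
   variation, and the first tau rounds cost at most G each. *)
Require Import Defs.
From mathcomp Require Import all_boot all_order all_algebra.
From mathcomp Require Import all_classical all_reals all_analysis.
From mathcomp Require Import ring lra zify.
Set Implicit Arguments.
Unset Strict Implicit.
Unset Printing Implicit Defensive.
Import Order.TTheory GRing.Theory Num.Theory numFieldNormedType.Exports.
Local Open Scope classical_set_scope.
Local Open Scope ring_scope.

Lemma le_of_sqr_le (R : realType) (a b : R) :
  0 <= b -> a ^+ 2 <= b ^+ 2 -> a <= b.
Proof.
move=> b0; apply: contraTT; rewrite -!ltNge => ba.
by rewrite ltr_pXn2r ?nnegrE// (le_trans b0)// ltW.
Qed.

(** * Euclidean inner product and norm on row vectors *)

Section Euclidean.
Context {R : realType} {n : nat}.
Implicit Types u v w : 'rV[R]_n.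

Lemma dotvC u v : dotv u v = dotv v u.
Proof. by apply: eq_bigr => i _; rewrite mulrC. Qed.

Lemma dotvDl u v w : dotv (u + v) w = dotv u w + dotv v w.
Proof. by rewrite -big_split; apply: eq_bigr => i _; rewrite mxE mulrDl. Qed.

Lemma dotvDr u v w : dotv u (v + w) = dotv u v + dotv u w.
Proof. by rewrite dotvC dotvDl !(dotvC u). Qed.

Lemma dotvZl a u v : dotv (a *: u) v = a * dotv u v.
Proof. by rewrite /dotv mulr_sumr; apply: eq_bigr => i _; rewrite mxE mulrA. Qed.

Lemma dotvNl u v : dotv (- u) v = - dotv u v.
Proof. by rewrite -scaleN1r dotvZl mulN1r. Qed.

Lemma dotvNr u v : dotv u (- v) = - dotv u v.
Proof. by rewrite dotvC dotvNl dotvC. Qed.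

Lemma l2norm_ge0 u : 0 <= l2norm u.
Proof. exact: sqrtr_ge0. Qed.

Lemma sqr_l2norm u : l2norm u ^+ 2 = dotv u u.
Proof.
rewrite sqr_sqrtr; last by apply: sumr_ge0 => i _; exact: sqr_ge0.
by apply: eq_bigr => i _; rewrite expr2.
Qed.

Lemma l2norm0 : l2norm (0 : 'rV[R]_n) = 0.
Proof. by rewrite /l2norm big1 ?sqrtr0// => i _; rewrite mxE expr0n. Qed.

Lemma l2normZ a u : 0 <= a -> l2norm (a *: u) = a * l2norm u.
Proof.
move=> a0; rewrite /l2norm (eq_bigr (fun i => a ^+ 2 * u 0 i ^+ 2)); last first.
  by move=> i _; rewrite mxE exprMn.
by rewrite -mulr_sumr sqrtrM ?sqr_ge0// sqrtr_sqr ger0_norm.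
Qed.

Lemma l2normN u : l2norm (- u) = l2norm u.
Proof. by congr Num.sqrt; apply: eq_bigr => i _; rewrite mxE sqrrN. Qed.

Lemma coord_le_l2norm u i : `|u 0 i| <= l2norm u.
Proof.
rewrite -sqrtr_sqr; apply: ler_wsqrtr.
by rewrite (bigD1 i)//= lerDl; apply: sumr_ge0 => j _; exact: sqr_ge0.
Qed.

Lemma l2norm_le u v : (forall i, `|u 0 i| <= `|v 0 i|) -> l2norm u <= l2norm v.
Proof.
move=> uv; apply: ler_wsqrtr; apply: ler_sum => i _.
by rewrite -[u 0 i ^+ 2]real_normK ?num_real// -[v 0 i ^+ 2]real_normK
  ?num_real// ler_pXn2r// nnegrE.
Qed.

Lemma l2norm_eq0 u : l2norm u = 0 -> u = 0.
Proof.
move=> u0; apply/rowP => i; rewrite mxE; apply/eqP; rewrite -normr_le0 -u0.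
exact: coord_le_l2norm.
Qed.

Lemma dotv_le u v : dotv u v <= l2norm u * l2norm v.
Proof.
(* Cauchy-Schwarz, by expanding | |v| u - |u| v |^2 >= 0 *)
have [/l2norm_eq0 ->|u0] := eqVneq (l2norm u) 0.
  by rewrite /dotv big1 ?mulr_ge0 ?l2norm_ge0// => i _; rewrite mxE mul0r.
have [/l2norm_eq0 ->|v0] := eqVneq (l2norm v) 0.
  by rewrite /dotv big1 ?mulr_ge0 ?l2norm_ge0// => i _; rewrite mxE mulr0.
have ab0 : 0 < l2norm u * l2norm v by rewrite mulr_gt0// lt_def ?u0 ?v0 l2norm_ge0.
have := sqr_ge0 (l2norm (l2norm v *: u - l2norm u *: v)).
rewrite sqr_l2norm !(dotvDl, dotvDr, dotvNl, dotvNr, dotvZl).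
rewrite !(dotvC _ (_ *: _)) !dotvZl -!sqr_l2norm (dotvC v u) => h.
by rewrite -(ler_pM2l ab0); nra.
Qed.

Lemma l2normD u v : l2norm (u + v) <= l2norm u + l2norm v.
Proof.
apply: le_of_sqr_le; first by rewrite addr_ge0 ?l2norm_ge0.
rewrite sqr_l2norm !(dotvDl, dotvDr) -!sqr_l2norm (dotvC v u).
by have := dotv_le u v; lra.
Qed.

(** The cross terms in the square of the sum are nonnegative. The Slater margin pairs with a sum of
    coordinates, which this turns into a norm. *)
Lemma l2norm_le_sum u : (forall i, 0 <= u 0 i) -> l2norm u <= \sum_i u 0 i.
Proof.
move=> u0; apply: le_of_sqr_le; first exact: sumr_ge0.
rewrite sqr_l2norm expr2 {1}mulr_suml; apply: ler_sum => i _.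
by rewrite ler_wpM2l// (bigD1 i)//= lerDl sumr_ge0.
Qed.

End Euclidean.

(** * One step of the virtual queue *)

Section VirtualQueue.
Context {R : realType} {C : nat} (q q' h : 'rV[R]_C).
Hypothesis q_ge0 : forall c, 0 <= q 0 c.
Hypothesis q'E : forall c, q' 0 c = Num.max (- h 0 c) (q 0 c + h 0 c).

Lemma queue_ge0 c : 0 <= q' 0 c.
Proof.
rewrite q'E; move: (q 0 c) (h 0 c) (q_ge0 c) => a b a0.
by rewrite le_max; case: (lerP 0 (- b)) => //= b0; lra.
Qed.

Lemma queueD_ge0 c : 0 <= q' 0 c + h 0 c.
Proof. by rewrite q'E -lerBlDr sub0r le_max lexx. Qed.

Lemma queue_incr c : q 0 c + h 0 c <= q' 0 c.
Proof. by rewrite q'E le_max lexx orbT. Qed.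

(** Coordinatewise, [q'] lies between 0 and [q + a], where [a] holds the absolute values of [h] and
    has the same norm. *)
Lemma queue_norm_le : l2norm q' <= l2norm q + l2norm h.
Proof.
pose a : 'rV[R]_C := \row_c `|h 0 c|.
have -> : l2norm h = l2norm a.
  by congr Num.sqrt; apply: eq_bigr => c _; rewrite mxE real_normK ?num_real.
apply: le_trans (l2normD _ _); apply: l2norm_le => c.
rewrite (ger0_norm (queue_ge0 c)) !mxE ger0_norm ?addr_ge0// q'E ge_max.
have := q_ge0 c; have := ler_norm (h 0 c); have := ler_norm (- h 0 c).
by rewrite normrN => *; apply/andP; split; lra.
Qed.

(** In each coordinate the slack is [(q + h) ^+ 2] if the maximum is [- h], and [h ^+ 2]
    otherwise. *)
Lemma queue_drift :
  l2norm q' ^+ 2 <= l2norm q ^+ 2 + 2 * (dotv q h + l2norm h ^+ 2).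
Proof.
rewrite !sqr_l2norm /dotv -big_split/= mulr_sumr -big_split/=.
apply: ler_sum => c _; rewrite q'E.
have := sqr_ge0 (q 0 c + h 0 c); have := sqr_ge0 (h 0 c).
by case: (lerP (- h 0 c) (q 0 c + h 0 c)) => _; lra.
Qed.

End VirtualQueue.

(** After the sums are exchanged, each shift [k < tau] sums [d] over a window inside [[1, m + tau]],
    so it costs at most the full sum. *)
Lemma lag_sum_le (R : realType) (d : nat -> R) (m tau : nat) :
  (forall t, (1 <= t)%N -> 0 <= d t) ->
  \sum_(1 <= j < m.+1) \sum_(0 <= k < tau) d (j + k).+1
    <= tau%:R * \sum_(1 <= t < (m + tau).+1) d t.
Proof.
move=> d0; rewrite exchange_big_nat/= mulr_natl -[in leRHS](subn0 tau) -sumr_const_nat.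
apply: ler_sum_nat => k /andP[_ kt].
have -> : \sum_(1 <= j < m.+1) d (j + k).+1 = \sum_(k.+2 <= t < (m + k).+2) d t.
  rewrite -[k.+2]/(1 + k.+1)%N (_ : (m + k).+2 = m.+1 + k.+1)%N; last by lia.
  by rewrite big_addn addnK; apply: eq_bigr => j _; rewrite addnS.
rewrite [leRHS](@big_cat_nat _ _ _ k.+2)/=; [|lia|lia].
rewrite [X in _ + X](@big_cat_nat _ _ _ (m + k).+2)/=; [|lia|lia].
rewrite addrCA lerDl addr_ge0// big_nat_cond sumr_ge0// => t /andP[/andP[lt _] _]; apply: d0; lia.
Qed.

Theorem theorem7 (R : realType) (n C T tau : nat)
  (X0 : set 'rV[R]_n)
  (f : nat -> 'rV[R]_n -> R) (g : nat -> 'rV[R]_n -> 'rV[R]_C)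
  (D beta G eps Rad : R)
  (alpha eta gamma : R)
  (x : nat -> 'rV[R]_n) (Q : nat -> 'rV[R]_C) (c : 'I_C)
  (hT : (1 <= T)%N) (htau : (1 <= tau)%N)
  (hX0_compact : compact X0) (hX0_convex : convex_set X0)
  (hf_convex : forall t, (1 <= t)%N -> convex_function setT (f t))
  (hf_diff : forall t, (1 <= t)%N -> forall y, differentiable (f t) y)
  (hg_convex : forall t, (1 <= t)%N -> forall c' : 'I_C,
     convex_function setT (fun y => g t y 0 c'))
  (hg0 : forall y, g 0%N y = 0)
  (* Assumption 1 *)
  (hD : 0 < D)
  (hgrad : forall t, (1 <= t)%N -> forall y, X0 y -> l2norm (grad (f t) y) <= D)
  (* Assumption 2 *)
  (hbeta : 0 < beta)
  (hg_lip : forall t, (1 <= t)%N -> forall y z, X0 y -> X0 z ->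
     l2norm (g t y - g t z) <= beta * l2norm (y - z))
  (hG : 0 < G)
  (hg_bound : forall t, (1 <= t)%N -> forall y, X0 y -> l2norm (g t y) <= G)
  (heps : 0 < eps)
  (hslater : forall t, (1 <= t)%N ->
     exists2 y, X0 y & forall c' : 'I_C, g t y 0 c' <= - eps)
  (* Assumption 3 *)
  (hRad : 0 < Rad)
  (hX0_diam : forall y z, X0 y -> X0 z -> l2norm (y - z) <= Rad)
  (halpha : 0 < alpha) (heta : 0 < eta) (hgamma : 0 < gamma)
  (hrun : dtc_oco X0 f g tau alpha eta gamma x Q) :
  violation g x c T <=
    2 * G
    + (2 * gamma ^+ 2 * G ^+ 2 + D * Rad + (alpha + eta) * Rad ^+ 2)
      / (eps * gamma ^+ 2)
    + tau%:R * g_variation X0 g T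
    + G * tau%:R.
Proof.
(* Assumption 2 starts at time 1, but index 0 occurs in [h tau] and in the first term of the
   variation. *)
have g0_norm y : l2norm (g 0%N y) <= G by rewrite hg0 l2norm0 ltW.
have g_norm t y : X0 y -> l2norm (g t y) <= G.
  by case: t => [|t] Xy; [exact: g0_norm | exact: hg_bound].
have xX0 t : (1 <= t)%N -> X0 (x t).
  move=> t1; have [tt|tt] := leqP t tau; first by apply: (dtc_init_x hrun); rewrite t1.
  by case: (dtc_x hrun tt).
have g_le t y : X0 y -> g t y 0 c <= G.
  move=> Xy; apply: le_trans (g_norm t y Xy).
  exact: le_trans (ler_norm _) (coord_le_l2norm _ _).
set d := fun t => sup [set l2norm (g t y - g (t - 1)%N y) | y in X0].
have d_ub t y : X0 y -> l2norm (g t y - g (t - 1)%N y) <= d t.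
  move=> Xy; apply: ub_le_sup; last by exists y.
  (* Boundedness by [2 * G] makes [sup] a genuine upper bound rather than a default value. *)
  exists (2 * G) => _ [z Xz <-]; apply: le_trans (l2normD _ _) _.
  by rewrite l2normN; have := g_norm t z Xz; have := g_norm (t - 1)%N z Xz; lra.
have d_ge0 t : 0 <= d t.
  exact: le_trans (l2norm_ge0 _) (d_ub t _ (xX0 1%N isT)).
(* [K] collects the terms of the optimality comparison other than the Slater one. One
   [(gamma * G) ^+ 2] comes from the product of [h t] and [h t.+1], the other from the squared norm
   of [h t.+1]. *)
set K := 2 * gamma ^+ 2 * G ^+ 2 + D * Rad + (alpha + eta) * Rad ^+ 2.
have K_ge0 : 0 <= K.
  by rewrite /K !addr_ge0// ?mulr_ge0 ?addr_ge0 ?sqr_ge0// ltW.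
(* The queue increment at time [t]; the weight of the constraint term in the objective at time
   [t.+1] is then [Q t + h t]. *)
pose h t : 'rV[R]_C := gamma *: g (t - tau)%N (x t).
have hE t c' : h t 0 c' = gamma * g (t - tau)%N (x t) 0 c' by rewrite mxE.
have h_norm t : (1 <= t)%N -> l2norm (h t) <= gamma * G.
  by move=> t1; rewrite l2normZ ?(ltW hgamma)// ler_pM2l// g_norm//; exact: xX0.
have QE t : (tau <= t)%N -> forall c',
    Q t.+1 0 c' = Num.max (- h t.+1 0 c') (Q t 0 c' + h t.+1 0 c').
  by move=> tt c'; rewrite (dtc_Q hrun)// subn1/= hE.
have Qtau : Q tau = 0 by apply: (dtc_init_Q hrun); rewrite htau leqnn.
have Q_ge0 m c' : 0 <= Q (tau + m)%N 0 c'.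
  elim: m c' => [|m IH] c'; first by rewrite addn0 Qtau mxE.
  by rewrite addnS; apply: (queue_ge0 IH); apply: QE; exact: leq_addr.
have QD_ge0 m c' : 0 <= Q (tau + m)%N 0 c' + h (tau + m)%N 0 c'.
  case: m => [|m]; first by rewrite addn0 Qtau hE subnn hg0 !mxE mulr0 addr0.
  by rewrite addnS; apply: queueD_ge0; apply: QE; exact: leq_addr.
(* Optimality of x_{t+1} against the Slater point of g_{t+1-tau}. *)
have Q_dot m :
  dotv (Q (tau + m)%N) (h (tau + m).+1) + l2norm (h (tau + m).+1) ^+ 2
    <= K - eps * gamma * (l2norm (Q (tau + m)%N) - gamma * G).
  set t := (tau + m)%N.
  have t1 : (1 <= t)%N by rewrite (leq_trans htau)// leq_addr.
  have tt : (tau < t.+1)%N by rewrite ltnS leq_addr.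
  have j1 : (1 <= t.+1 - tau)%N by rewrite subn_gt0.
  have [y Xy ys] := hslater _ j1.
  have [Xx /(_ _ Xy)] := dtc_x hrun tt.
  rewrite /dtc_objective subnAC subn1/=.
  rewrite -/(h t) -/(h t.+1).
  have Xz : X0 (x (t.+1 - tau)%N) by exact: xX0.
  have Xw : X0 (x t) by exact: xX0.
  move: (hgrad _ j1 _ Xz) => gD.
  set a := grad _ _ in gD *; set z := x (t.+1 - tau)%N; set w := x t.
  have sqrle u v : X0 u -> X0 v -> l2norm (u - v) ^+ 2 <= Rad ^+ 2.
    by move=> Xu Xv; rewrite ler_pXn2r ?nnegrE ?l2norm_ge0 ?(ltW hRad)// hX0_diam.
  have e1 := sqrle _ _ Xy Xz; have e2 := sqrle _ _ Xy Xw.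
  (* The weights [Q t + h t] are nonnegative, so the margin [eps] multiplies their sum, which is at
     least their norm, hence at least [l2norm (Q t) - gamma * G]. *)
  have slater : dotv (Q t + h t) (gamma *: g (t.+1 - tau)%N y)
      <= - (eps * gamma * (l2norm (Q t) - gamma * G)).
    apply: (@le_trans _ _ (- (eps * gamma) * \sum_i (Q t + h t) 0 i)).
      rewrite mulr_sumr; apply: ler_sum => i _.
      rewrite [X in _ * X]mxE mulrC ler_wpM2r//; first by rewrite mxE; exact: QD_ge0.
      by rewrite -mulNr mulrC ler_pM2r.
    rewrite mulNr lerN2 ler_pM2l ?mulr_gt0//.
    apply: (@le_trans _ _ (l2norm (Q t + h t))); last first.
      by apply: l2norm_le_sum => i; rewrite mxE; exact: QD_ge0.
    rewrite lerBlDr -[in leLHS](addrK (h t) (Q t)).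
    apply: le_trans (l2normD _ _) _; rewrite l2normN lerD2l; exact: h_norm.
  (* The base point [z] cancels, leaving the product of [a] with [y - x t.+1]. *)
  have gradle : dotv a (y - z) - dotv a (x t.+1 - z) <= D * Rad.
    rewrite -dotvNr -dotvDr opprB addrA subrK.
    by apply: le_trans (dotv_le _ _) _; rewrite ler_pM ?l2norm_ge0 ?hX0_diam.
  have hh : - (gamma * G) ^+ 2 <= dotv (h t) (h t.+1).
    rewrite lerNl -dotvNl; apply: le_trans (dotv_le _ _) _.
    by rewrite l2normN expr2 ler_pM ?l2norm_ge0 ?h_norm.
  have h2 : l2norm (h t.+1) ^+ 2 <= (gamma * G) ^+ 2.
    by rewrite !expr2 ler_pM ?l2norm_ge0 ?h_norm.
  rewrite (dotvDl _ _ (h t.+1)) /K => opt.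
  have a1 : alpha * l2norm (y - z) ^+ 2 <= alpha * Rad ^+ 2 by rewrite ler_pM2l.
  have a2 : eta * l2norm (y - w) ^+ 2 <= eta * Rad ^+ 2 by rewrite ler_pM2l.
  have a3 : 0 <= alpha * l2norm (x t.+1 - z) ^+ 2 by rewrite mulr_ge0 ?sqr_ge0 ?ltW.
  have a4 : 0 <= eta * l2norm (x t.+1 - w) ^+ 2 by rewrite mulr_ge0 ?sqr_ge0 ?ltW.
  rewrite exprMn in hh h2; lra.
(* Q_dot makes the drift nonpositive once |Q_t| >= gamma G + K / (eps gamma),
   and below that threshold one step adds at most gamma G. *)
have Q_norm m : l2norm (Q (tau + m)%N) <= 2 * (gamma * G) + K / (eps * gamma).
  have eg0 : 0 < eps * gamma by rewrite mulr_gt0.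
  have Keg : 0 <= K / (eps * gamma) by rewrite divr_ge0 // ltW.
  have gG : 0 < gamma * G by rewrite mulr_gt0.
  elim: m => [|m IH]; first by rewrite addn0 Qtau l2norm0; lra.
  rewrite addnS.
  have step := QE _ (leq_addr m tau).
  have [big|small] := leP (gamma * G + K / (eps * gamma)) (l2norm (Q (tau + m)%N)).
    apply: le_trans IH; apply: le_of_sqr_le; first exact: l2norm_ge0.
    apply: le_trans (queue_drift step) _.
    rewrite gerDl pmulr_rle0//; apply: le_trans (Q_dot m) _.
    by rewrite subr_le0 -ler_pdivrMl// mulrC lerBrDl.
  apply: le_trans (queue_norm_le (Q_ge0 m) step) _.
  by have := h_norm (tau + m).+1 isT; lra.
(* Telescopes [queue_incr] from [Q tau]; the summation index is that of the constraint, so [g j] is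
   evaluated at the later point [x (j + tau)]. *)
have sumQ m :
    gamma * \sum_(1 <= j < m.+1) g j (x (j + tau)%N) 0 c <= Q (tau + m)%N 0 c.
  elim: m => [|m IH]; first by rewrite big_geq// mulr0 Q_ge0.
  rewrite big_nat_recr//= mulrDr addnS.
  have := queue_incr (QE _ (leq_addr m tau)) c; apply: le_trans.
  rewrite hE (_ : (tau + m).+1 - tau = m.+1)%N; last by rewrite -addnS addKn.
  rewrite (_ : (tau + m).+1 = (m.+1 + tau)%N); last by rewrite addSn addnC.
  exact: lerD IH (lexx _).
(* Telescopes from [g j] to [g (j + tau)] at the fixed point [y], one term of [d] per unit of
   delay. *)
have lag j y : X0 y ->
    g (j + tau)%N y 0 c <= g j y 0 c + \sum_(0 <= k < tau) d (j + k).+1.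
  move=> Xy; elim: (tau) => [|k IH]; first by rewrite addn0 big_geq// addr0.
  rewrite big_nat_recr//= addnS addrA.
  have := le_trans (coord_le_l2norm _ c) (d_ub (j + k).+1 y Xy).
  rewrite subn1/= => /(le_trans (ler_norm _)); rewrite !mxE; lra.
have var_ge0 S : 0 <= g_variation X0 g S by apply: sumr_ge0 => t _; exact: d_ge0.
have Kdiv0 : 0 <= K / (eps * gamma ^+ 2) by rewrite divr_ge0// mulr_ge0 ?sqr_ge0// ltW.
have prefix S : \sum_(1 <= t < S.+1) g t (x t) 0 c <= G * S%:R.
  elim: S => [|S IH]; first by rewrite big_geq// mulr0.
  rewrite big_nat_recr//= -natr1 mulrDr mulr1; apply: lerD IH _.
  by apply: g_le; exact: xX0.
(* If [T <= tau], the term [G * tau%:R] alone dominates the violation and the other terms are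
   nonnegative. *)
rewrite /violation; have [Ttau|tauT] := leqP T tau.
  apply: le_trans (prefix T) _.
  have : G * T%:R <= G * tau%:R by rewrite ler_pM2l// ler_nat.
  have : 0 <= tau%:R * g_variation X0 g T by rewrite mulr_ge0.
  lra.
have [m Tm] : exists m, T = (m + tau)%N by exists (T - tau)%N; rewrite subnK// ltnW.
rewrite (@big_cat_nat _ _ _ tau.+1)//=; last exact: ltnW.
have tail : \sum_(tau.+1 <= t < T.+1) g t (x t) 0 c
    <= \sum_(1 <= j < m.+1) g j (x (j + tau)%N) 0 c + tau%:R * g_variation X0 g T.
  rewrite -[tau.+1]add1n big_addn Tm -addSn addnK.
  (* Since [m + tau] equals [T], the windows of [lag_sum_le] end exactly at the horizon. *)
  apply: le_trans (lerD (lexx _) (lag_sum_le _ _ (fun t _ => d_ge0 t))).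
  rewrite -big_split; apply: ler_sum_nat => j /andP[j1 _].
  by apply: lag; apply: xX0; rewrite (leq_trans j1)// leq_addr.
have Qc : \sum_(1 <= j < m.+1) g j (x (j + tau)%N) 0 c
    <= 2 * G + K / (eps * gamma ^+ 2).
  rewrite -(ler_pM2l hgamma); apply: le_trans (sumQ m) _.
  apply: le_trans (ler_norm _) _; apply: le_trans (coord_le_l2norm _ _) _.
  apply: le_trans (Q_norm m) _; rewrite le_eqVlt; apply/orP; left; apply/eqP.
  by field; rewrite !gt_eqF.
by have := prefix tau; lra.
Qed.
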